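(* For every quiver $G$ there is an isomorphism $$H_*^{\Delta,m}(G)\cong H_*^{\Delta,m}(\bar{\mathcal{R}}(G)),$$ natural with respect to induced maps: for every quiver map $m\colon G\to G'$ the isomorphisms intertwine $m_*\colon H_*^{\Delta,m}(G)\to H_*^{\Delta,m}(G')$ and $\bar{\mathcal{R}}(m)_*\colon H_*^{\Delta,m}(\bar{\mathcal{R}}(G))\to H_*^{\Delta,m}(\bar{\mathcal{R}}(G'))$.
   Context: A quiver $G=(V_G,E_G,s_G,t_G)$ consists of a non-empty set $V_G$ of vertices, a set $E_G$ of edges and functions $s_G,t_G\colon E_G\to V_G$. A quiver map $m\colon G\to G'$ is a pair $m_V\colon V_G\to V_{G'}$, $m_E\colon E_G\to E_{G'}\sqcup V_{G'}$ such that each edge $e$ is sent either to an edge with source $m_V(s(e))$ and target $m_V(t(e))$, or to the vertex $m_V(s(e))=m_V(t(e))$. Composition is the evident one (if an edge is sent to a vertex, the next vertex function is applied to it). $R$ is a fixed commutative ring. $\Delta^n$ is the quiver with vertices $0,\dots,n$ and exactly one edge $a\to b$ for each $a<b$ (no other edges); for $0\le i\le n$, $\delta_i\colon\Delta^{n-1}\to\Delta^n$ is the unique edge-to-edge map with $\delta_i(j)=j$ for $j<i$ and $j+1$ otherwise. $C_n^{\Delta,m}(G)$ is the free $R$-module on quiver maps $f\colon\Delta^n\to G$, with differential $\partial_n(f)=\sum_{i=0}^n(-1)^if\circ\delta_i$; $H_*^{\Delta,m}(G)$ is its homology, and a quiver map $\phi$ induces $\phi_*$ via $f\mapsto\phi\circ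 f$. The reduced digraph $\bar{\mathcal{R}}(G)$ has vertex set $V_G$ and exactly one edge $\bar{\mathcal{R}}(G,u,v)$, from $u$ to $v$, for each ordered pair $u\ne v$ such that there exists $e\in E_G$ with $s(e)=u$, $t(e)=v$ (and no other edges). For a quiver map $m\colon G\to G'$, $\bar{\mathcal{R}}(m)$ is given by $\bar{\mathcal{R}}(m)(v)=m(v)$ on vertices and on edges by $\bar{\mathcal{R}}(m)(\bar{\mathcal{R}}(G,u,v))=\bar{\mathcal{R}}(G',m(u),m(v))$ if $m(u)\neq m(v)$, and $\bar{\mathcal{R}}(m)(\bar{\mathcal{R}}(G,u,v))=m(u)$ if $m(u)=m(v)$. *)

(* Defs.v *)
From HB Require Import structures.
From mathcomp Require Import all_boot all_order all_algebra.
From mathcomp Require Import generic_quotient ring_quotient.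
From mathcomp Require Import finmap boolp.
From mathcomp Require Import zify.
From mathcomp.multinomials Require Import monalg.

Set Implicit Arguments.
Unset Strict Implicit.
Unset Printing Implicit Defensive.

Import GRing.Theory.
Local Open Scope ring_scope.
Local Open Scope quotient_scope.

Record quiver := Quiver {
  qvert : Type;
  qedge : Type;
  qsrc : qedge -> qvert;
  qtgt : qedge -> qvert;
  qvert_inh : inhabited qvert
}.

(* [inr v] means that the edge is sent to the vertex [v]. *)
Record quiver_map (G G' : quiver) := QuiverMap {
  mapV : qvert G -> qvert G';
  mapE : qedge G -> qedge G' + qvert G';
  mapP : forall e, match mapE e with
    | inl e' => qsrc e' = mapV (qsrc e) /\ qtgt e' = mapV (qtgt e)
    | inr v => v = mapV (qsrc e) /\ v = mapV (qtgt e)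
    end
}.

HB.instance Definition _ (G G' : quiver) := gen_eqMixin (quiver_map G G').
HB.instance Definition _ (G G' : quiver) := gen_choiceMixin (quiver_map G G').

Lemma quiver_map_eq (G G' : quiver) (f g : quiver_map G G') :
  mapV f =1 mapV g -> mapE f =1 mapE g -> f = g.
Proof.
case: f g => [fV fE fP] [gV gE gP] /= /funext eV /funext eE.
by move: fP gP; rewrite eV eE => fP gP; congr QuiverMap; apply: Prop_irrelevance.
Qed.

Definition qcomp_edge (G G' G'' : quiver) (g : quiver_map G' G'')
    (f : quiver_map G G') (e : qedge G) : qedge G'' + qvert G'' :=
  match mapE f e with
  | inl e' => mapE g e'
  | inr v => inr (mapV g v)
  end.

Lemma qcomp_subproof (G G' G'' : quiver) (g : quiver_map G' G'')
    (f : quiver_map G G') (e : qedge G) :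
  match qcomp_edge g f e with
  | inl e' => qsrc e' = mapV g (mapV f (qsrc e)) /\
              qtgt e' = mapV g (mapV f (qtgt e))
  | inr v => v = mapV g (mapV f (qsrc e)) /\ v = mapV g (mapV f (qtgt e))
  end.
Proof.
rewrite /qcomp_edge; have := mapP f e; case: (mapE f e) => [e' [<- <-]|v [<- <-]] //.
exact: (mapP g e').
Qed.

Definition qcomp (G G' G'' : quiver) (g : quiver_map G' G'')
    (f : quiver_map G G') : quiver_map G G'' :=
  QuiverMap (mapV := fun v => mapV g (mapV f v)) (qcomp_subproof g f).

Lemma qcompA (G1 G2 G3 G4 : quiver) (h : quiver_map G3 G4)
    (g : quiver_map G2 G3) (f : quiver_map G1 G2) :
  qcomp h (qcomp g f) = qcomp (qcomp h g) f.
Proof.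
apply: quiver_map_eq => //= e; rewrite /qcomp_edge /= /qcomp_edge.
by case: (mapE f e).
Qed.

Definition simplex (n : nat) : quiver := {|
  qvert := 'I_n.+1;
  qedge := {ab : 'I_n.+1 * 'I_n.+1 | (ab.1 < ab.2)%N};
  qsrc := fun e => (val e).1;
  qtgt := fun e => (val e).2;
  qvert_inh := inhabits ord0
|}.

Lemma face_lt (n : nat) (i : 'I_n.+2) (e : qedge (simplex n)) :
  (lift i (val e).1 < lift i (val e).2)%N.
Proof. by rewrite !ltnNge leq_bump2 -ltnNge; exact: (valP e). Qed.

(* [lift i j] is [j] for [j < i] and [j + 1] otherwise. *)
Definition face (n : nat) (i : 'I_n.+2) :
    quiver_map (simplex n) (simplex n.+1) :=
  @QuiverMap (simplex n) (simplex n.+1) (lift i)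
    (fun e => inl (exist _ (lift i (val e).1, lift i (val e).2) (face_lt i e)))
    (fun e => conj erefl erefl).

Lemma face_comp (n : nat) (i i' : 'I_n.+3) (j j' : 'I_n.+2) :
  i' = j :> nat -> i = j'.+1 :> nat -> (j <= j')%N ->
  qcomp (face i) (face j) = qcomp (face i') (face j').
Proof.
move=> ei' ei lejj'.
have e (k : 'I_n.+1) : lift i (lift j k) = lift i' (lift j' k).
  by apply: val_inj; rewrite /= ei ei' /bump; lia.
apply: quiver_map_eq => //= x; rewrite /qcomp_edge /=.
by congr inl; apply: val_inj; rewrite /= !e.
Qed.

(* [{malg R[T]}] has its module structure only for nonzero rings [R]. *)
Definition free_mod (R : pzRingType) (T : choiceType) : Type := {malg R[T]}.

Section FreeModule.
Variables (R : pzRingType) (T : choiceType).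
Implicit Types (x y : free_mod R T) (a b : R).

HB.instance Definition _ := GRing.Zmodule.on (free_mod R T).

Definition free_scale a x : free_mod R T := [malg t in msupp x => a * x@_t].

Lemma free_scaleE a x t : (free_scale a x)@_t = a * x@_t.
Proof. by rewrite mcoeffE; case: msuppP; rewrite ?mulr0. Qed.

Fact free_scaleA a b x : free_scale a (free_scale b x) = free_scale (a * b) x.
Proof. by apply/malgP => t; rewrite !free_scaleE mulrA. Qed.

Fact free_scale1 : left_id 1 free_scale.
Proof. by move=> x; apply/malgP => t; rewrite free_scaleE mul1r. Qed.

Fact free_scaleDr : right_distributive free_scale +%R.
Proof.
by move=> a x y; apply/malgP => t; rewrite free_scaleE !mcoeffD !free_scaleE mulrDr.
Qed.

Fact free_scaleDl x : {morph free_scale^~ x : a b / a + b}.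
Proof.
by move=> a b; apply/malgP => t; rewrite free_scaleE mcoeffD !free_scaleE mulrDl.
Qed.

HB.instance Definition _ := GRing.Zmodule_isLmodule.Build R (free_mod R T)
  free_scaleA free_scale1 free_scaleDr free_scaleDl.

Definition free_gen (t : T) : free_mod R T := << t >>.

Variables (V : lmodType R) (f : T -> V).

Definition free_ext x : V := \sum_(t <- msupp x) x@_t *: f t.

Lemma free_ext_widen (d : {fset T}) x :
  (msupp x `<=` d)%fset -> free_ext x = \sum_(t <- d) x@_t *: f t.
Proof.
move=> sxd; rewrite /free_ext (big_fset_incl _ sxd) // => t _.
by move=> /mcoeff_outdom ->; rewrite scale0r.
Qed.

Fact free_ext_linear : linear free_ext.
Proof.
move=> a x y; pose d := (msupp x `|` msupp y `|` msupp (a *: x + y))%fset.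
rewrite !(@free_ext_widen d) /d; try by apply/fsubsetP => t; rewrite !inE => ->; rewrite ?orbT.
rewrite scaler_sumr -big_split; apply: eq_bigr => t _ /=.
by rewrite mcoeffD free_scaleE scalerDl scalerA.
Qed.

HB.instance Definition _ :=
  GRing.isLinear.Build R (free_mod R T) V _ free_ext free_ext_linear.

Lemma free_ext_gen (t : T) : free_ext (free_gen t) = f t.
Proof.
rewrite (@free_ext_widen [fset t]%fset) ?msuppU_le //.
by rewrite big_seq_fset1 mcoeffUU scale1r.
Qed.

Lemma free_linear_eq (h k : {linear free_mod R T -> V}) :
  (forall t, h (free_gen t) = k (free_gen t)) -> h =1 k.
Proof.
move=> hk x.
have -> : x = \sum_(t <- msupp x) x@_t *: free_gen t.
  rewrite [LHS]monalgE; apply: eq_bigr => t _; apply/malgP => u.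
  by rewrite free_scaleE !mcoeffU mulr_natr mulrb; case: eqP.
by rewrite !linear_sum; apply: eq_bigr => t _; rewrite !linearZ hk.
Qed.

End FreeModule.

Section QuotLmodule.
Variables (R : pzRingType) (V : lmodType R) (S : submodClosed V).

(* [submodClosed] does not inherit from [zmodClosed], over which
   [Quotient.quot] is defined. *)
Definition submod_pred : {pred V} := S.

Fact submod_pred_closed : zmod_closed submod_pred.
Proof.
by split=> [|x y Sx Sy]; [exact: rpred0 | rewrite -scaleN1r rpredD ?rpredZ].
Qed.

HB.instance Definition _ :=
  GRing.isZmodClosed.Build V submod_pred submod_pred_closed.

Definition quot_mod : Type := Quotient.quot submod_pred.
Local Notation Q := quot_mod.

HB.instance Definition _ := GRing.Zmodule.on Q.
HB.instance Definition _ := EqQuotient.on Q.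
HB.instance Definition _ := ZmodQuotient.on Q.

Definition quot_scale (a : R) : Q -> Q := lift_op1 Q ( *:%R a).

Lemma pi_quot_scale (a : R) : {morph \pi_Q : v / a *: v >-> quot_scale a v}.
Proof.
move=> v; unlock quot_scale; apply/eqP; rewrite piE Quotient.equivE.
rewrite -scalerBr; apply: (rpredZ (s := S)).
have: v - repr (\pi_Q v) \in submod_pred by rewrite Quotient.idealrBE reprK.
by [].
Qed.

Fact quot_scaleA (a b : R) (q : Q) :
  quot_scale a (quot_scale b q) = quot_scale (a * b) q.
Proof. by rewrite -[q]reprK -!pi_quot_scale scalerA. Qed.

Fact quot_scale1 : left_id 1 quot_scale.
Proof. by move=> q; rewrite -[q]reprK -pi_quot_scale scale1r. Qed.

Fact quot_scaleDr : right_distributive quot_scale +%R.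
Proof.
move=> a p q; rewrite -[p]reprK -[q]reprK -raddfD -!pi_quot_scale.
by rewrite scalerDr raddfD.
Qed.

Fact quot_scaleDl (q : Q) : {morph quot_scale^~ q : a b / a + b}.
Proof.
by move=> a b; rewrite -[q]reprK -!pi_quot_scale scalerDl raddfD.
Qed.

HB.instance Definition _ := GRing.Zmodule_isLmodule.Build R Q
  quot_scaleA quot_scale1 quot_scaleDr quot_scaleDl.

HB.instance Definition _ :=
  GRing.isScalable.Build R V Q *:%R \pi_Q pi_quot_scale.

Lemma pi_quot_eq (x y : V) : \pi_Q x = \pi_Q y <-> x - y \in S.
Proof.
by rewrite -[_ \in S]/(_ \in submod_pred) Quotient.idealrBE; split=> [->//|/eqP].
Qed.

End QuotLmodule.

Section Homology.
Variables (R : pzRingType) (A B C : lmodType R).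
Variables (f : {linear A -> B}) (g : {linear B -> C}).

Definition is_cycle : {pred B} := fun x => g x == 0.

Fact is_cycle_closed : submod_closed is_cycle.
Proof.
split=> [|a x y]; rewrite !unfold_in ?linear0 // => /eqP gx /eqP gy.
by rewrite linearP gx gy scaler0 addr0.
Qed.

HB.instance Definition _ :=
  GRing.isSubmodClosed.Build R B is_cycle is_cycle_closed.

Record cycles := Cycle { cycle_val : B; cycleP : cycle_val \in is_cycle }.
HB.instance Definition _ := [isSub for cycle_val].
HB.instance Definition _ := [Choice of cycles by <:].
HB.instance Definition _ := [SubChoice_isSubLmodule of cycles by <:].

Definition is_boundary : {pred cycles} := fun z => `[< exists a, f a = val z >].

Fact is_boundary_closed : submod_closed is_boundary.
Proof.
split=> [|k x y]; rewrite !unfold_in.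
  by apply/asboolP; exists 0; rewrite linear0 raddf0.
move=> /asboolP[a fa] /asboolP[b fb]; apply/asboolP.
by exists (k *: a + b); rewrite !linearP fa fb.
Qed.

HB.instance Definition _ :=
  GRing.isSubmodClosed.Build R cycles is_boundary is_boundary_closed.

(* The kernel of [g] modulo the image of [f]; meant for [g \o f = 0]. *)
Definition homology : lmodType R := quot_mod is_boundary.

Definition homology_class (z : cycles) : homology := \pi z.

End Homology.

Section HomologyMap.
Variables (R : pzRingType) (A B C A' B' C' : lmodType R).
Variables (f : {linear A -> B}) (g : {linear B -> C}).
Variables (f' : {linear A' -> B'}) (g' : {linear B' -> C'}).
Variables (hA : {linear A -> A'}) (hB : {linear B -> B'}) (hC : {linear C -> C'}).
Hypothesis hf : forall x, hB (f x) = f' (hA x).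
Hypothesis hg : forall x, hC (g x) = g' (hB x).

Fact cycle_map_subproof (z : cycles g) : hB (cycle_val z) \in is_cycle g'.
Proof.
by rewrite unfold_in -hg; move/eqP: (cycleP z) => ->; rewrite linear0.
Qed.

Definition cycle_map (z : cycles g) : cycles g' := Cycle (cycle_map_subproof z).

Fact cycle_map_linear : linear cycle_map.
Proof. by move=> a x y; apply: val_inj; rewrite /= linearP. Qed.

HB.instance Definition _ :=
  GRing.isLinear.Build R (cycles g) (cycles g') _ cycle_map cycle_map_linear.

Definition homology_map (q : homology f g) : homology f' g' :=
  homology_class f' (cycle_map (repr q)).

Lemma homology_mapE (z : cycles g) :
  homology_map (homology_class f z) = homology_class f' (cycle_map z).
Proof.
apply/pi_quot_eq; rewrite -linearB.
have: repr (homology_class f z) - z \in is_boundary f (g := g).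
  by apply/pi_quot_eq; rewrite reprK.
move=> /asboolP[a fa]; apply/asboolP; exists (hA a).
by rewrite -hf fa.
Qed.

Fact homology_map_linear : linear homology_map.
Proof.
move=> a p q; rewrite -[p]reprK -[q]reprK -linearP.
by rewrite !homology_mapE linearP [LHS]linearP.
Qed.

End HomologyMap.

Arguments homology_map {R A B C A' B' C'} f {g} f' {g' hB hC} hg q.

Section Chains.
Variable R : pzRingType.
Implicit Types (G : quiver) (n : nat).

Definition chain G n : lmodType R := free_mod R (quiver_map (simplex n) G).

Definition face_sum G n (f : quiver_map (simplex n.+1) G) : chain G n :=
  \sum_(i < n.+2) (-1) ^+ i *: free_gen R (qcomp f (face i)).

(* [n.-1 = 0] for [n = 0], where the differential is zero. *)
Definition diff G n : {linear chain G n -> chain G n.-1} :=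
  match n with
  | 0 => \0
  | m.+1 => free_ext (@face_sum G m)
  end.

Definition chain_map G G' (phi : quiver_map G G') n :
    {linear chain G n -> chain G' n} :=
  free_ext (fun f => free_gen R (qcomp phi f)).

Lemma diff_gen G n (f : quiver_map (simplex n.+1) G) :
  diff G n.+1 (free_gen R f) = face_sum f.
Proof. exact: free_ext_gen. Qed.

Lemma chain_map_gen G G' (phi : quiver_map G G') n
    (f : quiver_map (simplex n) G) :
  chain_map phi n (free_gen R f) = free_gen R (qcomp phi f).
Proof. exact: free_ext_gen. Qed.

Lemma chain_map_diff G G' (phi : quiver_map G G') n (x : chain G n) :
  chain_map phi n.-1 (diff G n x) = diff G' n (chain_map phi n x).
Proof.
case: n x => [|n] x /=; first by rewrite linear0.
pose l : {linear _ -> _} := chain_map phi n \o diff G n.+1.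
pose r : {linear _ -> _} := diff G' n.+1 \o chain_map phi n.+1.
apply: (@free_linear_eq _ _ _ l r) => f.
rewrite -[l _]/(chain_map phi n (diff G n.+1 _)) diff_gen.
rewrite -[r _]/(diff G' n.+1 (chain_map phi n.+1 _)) chain_map_gen diff_gen.
rewrite linear_sum; apply: eq_bigr => i _.
by rewrite linearZ; congr (_ *: _); rewrite chain_map_gen qcompA.
Qed.

Lemma diff_diff G n (x : chain G n.+1) : diff G n (diff G n.+1 x) = 0.
Proof.
case: n x => [|n] x //.
pose l : {linear _ -> _} := diff G n.+1 \o diff G n.+2.
pose r : {linear chain G n.+2 -> chain G n} := \0.
apply: (@free_linear_eq _ _ _ l r) => f.
rewrite -[l _]/(diff G n.+1 (diff G n.+2 _)) diff_gen linear_sum /=.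
pose t (p : 'I_n.+3 * 'I_n.+2) : chain G n := (-1) ^+ (p.1 + p.2) *:
  free_gen R (qcomp f (qcomp (face p.1) (face p.2))).
transitivity (\sum_p t p).
  rewrite -(pair_bigA _ (fun i j => t (i, j))) /=; apply: eq_bigr => i _.
  rewrite linearZZ diff_gen /face_sum scaler_sumr; apply: eq_bigr => j _.
  by rewrite /t /= scalerA exprD -qcompA.
rewrite (bigID (fun p : 'I_n.+3 * 'I_n.+2 => p.1 <= p.2)%N) /= addrC.
pose h (p : 'I_n.+3 * 'I_n.+2) : 'I_n.+3 * 'I_n.+2 := (lift ord0 p.2, inord p.1).
pose k (p : 'I_n.+3 * 'I_n.+2) : 'I_n.+3 * 'I_n.+2 :=
  (widen_ord (leqnSn _) p.2, inord p.1.-1).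
rewrite (reindex_onto h k) /=; last first.
  move=> [a b] /=; rewrite -ltnNge => ltba.
  have [lta ltb] := (ltn_ord a, ltn_ord b).
  rewrite /h /k /=; congr (_, _); apply: val_inj; rewrite /= ?/bump inordK //=; lia.
rewrite -[X in _ + X]opprK; apply/eqP; rewrite subr_eq0 -sumrN; apply/eqP.
have inordE (a : 'I_n.+3) (b : 'I_n.+2) :
    (a <= b)%N -> (inord a : 'I_n.+2) = a :> nat.
  by move=> leab; rewrite inordK //; have := ltn_ord b; lia.
apply: eq_big => [[a b]|[a b]] /=.
  rewrite -ltnNge /bump leq0n add1n; apply/andP/idP.
    case=> lt /eqP[/(congr1 val) /= ea _].
    by move: lt; rewrite ea; lia.
  move=> leab; have ea := inordE _ _ leab; split; first by rewrite ea; lia.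
  apply/eqP; congr (_, _); apply: val_inj => /=; first by rewrite ea.
  by rewrite add0n inord_val.
case/andP; rewrite -ltnNge /bump leq0n add1n => lt /eqP[/(congr1 val) /= ea _].
rewrite /t /= -scaleNr ea; congr (_ *: _).
  by rewrite /bump leq0n add1n addSn exprS mulN1r addnC.
congr (free_gen R (qcomp f _)); apply: face_comp => //=.
Qed.

Definition simp_homology G n : lmodType R := homology (diff G n.+1) (diff G n).

Definition simp_homology_map G G' (phi : quiver_map G G') n :
    simp_homology G n -> simp_homology G' n :=
  homology_map (diff G n.+1) (diff G' n.+1) (chain_map_diff phi (n := n)).

Fact simp_homology_map_linear G G' (phi : quiver_map G G') n :
  linear (@simp_homology_map G G' phi n).
Proof. exact: homology_map_linear (chain_map_diff phi (n := n.+1)) _. Qed.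

HB.instance Definition _ G G' (phi : quiver_map G G') n :=
  GRing.isLinear.Build R (simp_homology G n) (simp_homology G' n) _
    (@simp_homology_map G G' phi n)
    (@simp_homology_map_linear G G' phi n).

End Chains.

Arguments simp_homology_map {R G G'} phi n q.

(* One edge per admissible pair, by proof irrelevance. *)
Definition redge (G : quiver) : Type :=
  {uv : qvert G * qvert G |
    uv.1 <> uv.2 /\ exists e : qedge G, qsrc e = uv.1 /\ qtgt e = uv.2}.

Definition reduced (G : quiver) : quiver := {|
  qvert := qvert G;
  qedge := redge G;
  qsrc := fun uv => (sval uv).1;
  qtgt := fun uv => (sval uv).2;
  qvert_inh := qvert_inh G
|}.

Section ReducedMap.
Variables (G G' : quiver) (m : quiver_map G G').

Lemma redge_map_subproof (uv : redge G) :
    mapV m (sval uv).1 <> mapV m (sval uv).2 ->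
  let mu := mapV m (sval uv).1 in let mv := mapV m (sval uv).2 in
  mu <> mv /\ exists e : qedge G', qsrc e = mu /\ qtgt e = mv.
Proof.
move=> neq; split=> //; case: uv neq => [[u v] [_ [e /= [<- <-]]]] /= neq.
by have := mapP m e; case: (mapE m e) => [e' eP|w [] -> /neq] //; exists e'.
Qed.

Definition redge_map (uv : redge G) : redge G' + qvert G' :=
  match pselect (mapV m (sval uv).1 = mapV m (sval uv).2) with
  | left _ => inr (mapV m (sval uv).1)
  | right neq => inl (exist _ (mapV m (sval uv).1, mapV m (sval uv).2)
                            (redge_map_subproof neq))
  end.

Lemma reduced_map_subproof (uv : qedge (reduced G)) :
  match redge_map uv with
  | inl e' => (sval e').1 = mapV m (sval uv).1 /\
              (sval e').2 = mapV m (sval uv).2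
  | inr v => v = mapV m (sval uv).1 /\ v = mapV m (sval uv).2
  end.
Proof. by rewrite /redge_map; case: pselect. Qed.

Definition reduced_map : quiver_map (reduced G) (reduced G') :=
  @QuiverMap (reduced G) (reduced G') (mapV m) redge_map reduced_map_subproof.

End ReducedMap.

(* Main.v *)
Require Import Defs.
From mathcomp Require Import all_boot all_order all_algebra.
From mathcomp Require Import boolp zify.
Local Open Scope ring_scope.

(** The isomorphism is induced by the evident quiver map from [G] to its reduced
    digraph, which collapses loops and parallel edges. Choosing an edge for each
    admissible pair of vertices gives a section of it, so it is enough that two
    quiver maps [p] and [q] which agree on vertices are chain homotopic. The
    usual prism operator works: on a prism over a simplex, label with [p] every
    edge starting at the bottom and with [q] every edge of the top. As a quiver
    map out of a simplex chooses its edges independently of each other, no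
    compatibility between these labels is required. *)

Set Implicit Arguments.
Unset Strict Implicit.
Unset Printing Implicit Defensive.

Import GRing.Theory.

(** * Quiver maps determined by their action on vertices *)

(** Without loops or parallel edges in the target, the images of the endpoints of an edge decide
    whether it goes to an edge or a vertex, and to which one. *)
Lemma quiver_map_eqV (G G' : quiver) (f g : quiver_map G G') :
  (forall e : qedge G', qsrc e <> qtgt e) ->
  (forall e e' : qedge G', qsrc e = qsrc e' -> qtgt e = qtgt e' -> e = e') ->
  mapV f =1 mapV g -> f = g.
Proof.
move=> loopless simple efg; apply: quiver_map_eq => // e.
have := Defs.mapP f e; have := Defs.mapP g e; rewrite !efg.
case: (mapE f e) (mapE g e) => [a|v] [b|w] [e1 e2] [e3 e4].
- by congr inl; apply: simple; congruence.
- by case: (loopless a); congruence.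
- by case: (loopless b); congruence.
- by congr inr; congruence.
Qed.

Lemma simplex_map_eqV (G : quiver) (n : nat) (f g : quiver_map G (simplex n)) :
  mapV f =1 mapV g -> f = g.
Proof.
apply: quiver_map_eqV => [[[a b] /= ltab] eab|[[a b] ltab] [[c d] ltcd] /= eac ebd].
  by move: ltab; rewrite eab ltnn.
by apply: val_inj; rewrite /= eac ebd.
Qed.

Lemma reduced_map_eqV (G G' : quiver) (f g : quiver_map G (reduced G')) :
  mapV f =1 mapV g -> f = g.
Proof.
apply: quiver_map_eqV => [[uv [neq ex]] //|[[a b] ab] [[c d] cd] /= eac ebd].
by move: ab cd; rewrite eac ebd => ab cd; congr exist; apply: Prop_irrelevance.
Qed.

Definition qid (G : quiver) : quiver_map G G :=
  @QuiverMap G G id inl (fun e => conj erefl erefl).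

Lemma qcomp_id (G G' : quiver) (f : quiver_map G G') : qcomp f (qid G) = f.
Proof. exact: quiver_map_eq. Qed.

Lemma qcomp_idl (G G' : quiver) (f : quiver_map G G') : qcomp (qid G') f = f.
Proof. by apply: quiver_map_eq => //= e; rewrite /qcomp_edge; case: (mapE f e). Qed.

(** * The projection to the reduced digraph and its section *)

Section ReducedProjection.
Variable G : quiver.

Definition reduced_edge (e : qedge G) : redge G + qvert G :=
  match pselect (qsrc e = qtgt e) with
  | left _ => inr (qsrc e)
  | right neq => inl (exist _ (qsrc e, qtgt e)
      (conj neq (ex_intro _ e (conj erefl erefl))))
  end.

Lemma reduced_edgeP (e : qedge G) :
  match reduced_edge e with
  | inl e' => (sval e').1 = qsrc e /\ (sval e').2 = qtgt e
  | inr v => v = qsrc e /\ v = qtgt e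
  end.
Proof. by rewrite /reduced_edge; case: pselect. Qed.

Definition reduced_proj : quiver_map G (reduced G) :=
  @QuiverMap G (reduced G) id reduced_edge reduced_edgeP.

Definition reduced_section : quiver_map (reduced G) G :=
  @QuiverMap (reduced G) G id
    (fun uv => inl (sval (cid (proj2 (svalP uv)))))
    (fun uv => svalP (cid (proj2 (svalP uv)))).

End ReducedProjection.

(** * Codegeneracies and cosimplicial identities *)

Section Degeneracy.
Variables (n i : nat).

(* [minn] only serves to keep the values in range when [n < i]. *)
Definition degenV (k : 'I_n.+2) : 'I_n.+1 := inord (minn n (unbump i k)).

Lemma degenVE (k : 'I_n.+2) : degenV k = minn n (unbump i k) :> nat.
Proof. by rewrite inordK // ltnS geq_minl. Qed.

(** As [degenV] is weakly monotone, [insub] fails exactly when both endpoints have the same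
    image. *)
Definition degenE (e : qedge (simplex n.+1)) :
    qedge (simplex n) + qvert (simplex n) :=
  if insub (degenV (val e).1, degenV (val e).2) is Some e' then inl e'
  else inr (degenV (val e).1).

Lemma degenP (e : qedge (simplex n.+1)) :
  match degenE e with
  | inl e' => (val e').1 = degenV (val e).1 /\ (val e').2 = degenV (val e).2
  | inr v => v = degenV (val e).1 /\ v = degenV (val e).2
  end.
Proof.
rewrite /degenE; case: insubP => [e' _ -> //|] /=.
rewrite -leqNgt => ge; split=> //; apply: val_inj; apply/eqP => /=.
rewrite eqn_leq ge andbT !degenVE /unbump.
by have := valP e; rewrite /=; lia.
Qed.

(** For [i <= n], the codegeneracy that takes the value [i] at both [i] and [i.+1]. *)
Definition degen : quiver_map (simplex n.+1) (simplex n) :=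
  @QuiverMap (simplex n.+1) (simplex n) degenV degenE degenP.

End Degeneracy.

Lemma degen_face_id (n i : nat) (j : 'I_n.+2) :
  (i <= n)%N -> (i <= j <= i.+1)%N -> qcomp (degen n i) (face j) = qid _.
Proof.
move=> lein ij; apply: simplex_map_eqV => k; apply: val_inj => /=.
by rewrite degenVE /= /unbump /bump; have := ltn_ord k; lia.
Qed.

Lemma degen_face_lt (n i : nat) (j : 'I_n.+3) (j' : 'I_n.+2) :
  j = j' :> nat -> (j <= i <= n)%N ->
  qcomp (degen n.+1 i.+1) (face j) = qcomp (face j') (degen n i).
Proof.
move=> ej ji; apply: simplex_map_eqV => k; apply: val_inj => /=.
rewrite degenVE /= degenVE /unbump /bump ej; have := ltn_ord k; lia.
Qed.

Lemma degen_face_gt (n i : nat) (j : 'I_n.+3) (j' : 'I_n.+2) :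
  j = j'.+1 :> nat -> (i < j')%N ->
  qcomp (degen n.+1 i) (face j) = qcomp (face j') (degen n i).
Proof.
move=> ej ij; apply: simplex_map_eqV => k; apply: val_inj => /=.
rewrite degenVE /= degenVE /unbump /bump ej.
by have := ltn_ord k; have := ltn_ord j'; lia.
Qed.

(** * Mixed labels and prisms *)

Section Mix.
Variables (G G' : quiver) (p q : quiver_map G G').
Hypothesis epq : mapV p =1 mapV q.

Section MixMap.
Variables (k n : nat) (f : quiver_map (simplex n) G).

(** The threshold [k] interpolates between [qcomp q f] at [k = 0] and [qcomp p f] at [k = n.+1]. *)
Definition mixE (e : qedge (simplex n)) : qedge G' + qvert G' :=
  if (k <= (val e).1)%N then qcomp_edge q f e else qcomp_edge p f e.

Lemma mixP (e : qedge (simplex n)) :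
  match mixE e with
  | inl e' => qsrc e' = mapV p (mapV f (qsrc e)) /\
              qtgt e' = mapV p (mapV f (qtgt e))
  | inr v => v = mapV p (mapV f (qsrc e)) /\ v = mapV p (mapV f (qtgt e))
  end.
Proof.
rewrite /mixE; case: ifP => _; last exact: qcomp_subproof.
by rewrite !epq; exact: qcomp_subproof.
Qed.

Definition mix : quiver_map (simplex n) G' :=
  QuiverMap (mapV := fun v => mapV p (mapV f v)) mixP.

End MixMap.

Lemma mix0 (n : nat) (f : quiver_map (simplex n) G) : mix 0 f = qcomp q f.
Proof. by apply: quiver_map_eq => //= v; rewrite epq. Qed.

Lemma mix_max (n : nat) (f : quiver_map (simplex n) G) :
  mix n.+1 f = qcomp p f.
Proof. by apply: quiver_map_eq => //= e; rewrite /mixE leqNgt ltn_ord. Qed.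

(** The face skips vertex [j], so the thresholds [j] and [j.+1] cut it at the same place; [j] is not
    a value of [bump j], hence the second alternative. *)
Lemma mix_face (k k' n : nat) (f : quiver_map (simplex n.+1) G) (j : 'I_n.+2) :
  k = bump j k' \/ (k = j /\ k' = j) ->
  qcomp (mix k f) (face j) = mix k' (qcomp f (face j)).
Proof.
move=> ek; apply: quiver_map_eq => //= e.
rewrite /qcomp_edge /= /mixE /= /qcomp_edge /=.
by have -> : (k <= bump j (val e).1)%N = (k' <= (val e).1)%N
  by rewrite /bump in ek *; lia.
Qed.

(** The [i]-th simplex in the triangulation of the prism: vertices up to [i] lie at the bottom,
    later ones on top, hence the threshold [i.+1]. *)
Definition prism (i n : nat) (f : quiver_map (simplex n) G) :
    quiver_map (simplex n.+1) G' :=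
  mix i.+1 (qcomp f (degen n i)).

(** The face undoes the codegeneracy. What remains depends on [j] but not on [i], so consecutive
    prisms share a face, which makes the sum telescope. *)
Lemma prism_face_id (i n : nat) (f : quiver_map (simplex n) G) (j : 'I_n.+2) :
  (i <= n)%N -> (i <= j <= i.+1)%N -> qcomp (prism i f) (face j) = mix j f.
Proof.
move=> lein ij; rewrite /prism (@mix_face _ j); last by rewrite /bump; lia.
by rewrite -qcompA degen_face_id // qcomp_id.
Qed.

Lemma prism_face_lt (i n : nat) (f : quiver_map (simplex n.+1) G)
    (j : 'I_n.+3) (j' : 'I_n.+2) :
  j = j' :> nat -> (j <= i <= n)%N ->
  qcomp (prism i.+1 f) (face j) = prism i (qcomp f (face j')).
Proof.
move=> ej ji; rewrite /prism (@mix_face _ i.+1); last by rewrite /bump; lia.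
by rewrite -!qcompA (degen_face_lt ej).
Qed.

Lemma prism_face_gt (i n : nat) (f : quiver_map (simplex n.+1) G)
    (j : 'I_n.+3) (j' : 'I_n.+2) :
  j = j'.+1 :> nat -> (i < j')%N ->
  qcomp (prism i f) (face j) = prism i (qcomp f (face j')).
Proof.
move=> ej ij; rewrite /prism (@mix_face _ i.+1); last by rewrite /bump; lia.
by rewrite -!qcompA (degen_face_gt ej).
Qed.

End Mix.

(** The sign bookkeeping of the homotopy formula. Read [T j i] as face [j] of prism [i], [S j i] as
    prism [i] over face [j], and [F j] as the simplex mixed at threshold [j]. *)
Lemma prism_sum (R : pzRingType) (V : lmodType R) (n : nat)
    (T S : nat -> nat -> V) (F : nat -> V) :
  (forall i j, (j <= i < n)%N -> T j i.+1 = S j i) ->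
  (forall i j, (i <= n)%N -> (i <= j <= i.+1)%N -> T j i = F j) ->
  (forall i j, (i < j <= n)%N -> T j.+1 i = S j i) ->
  \sum_(0 <= i < n.+1) \sum_(0 <= j < n.+2) (-1) ^+ (i + j) *: T j i
  + \sum_(0 <= i < n) \sum_(0 <= j < n.+1) (-1) ^+ (i + j) *: S j i
  = F 0 - F n.+1.
Proof.
move=> Tlt Tid Tgt.
pose A i := \sum_(0 <= j < i) (-1) ^+ (i + j) *: T j i.
pose B i := \sum_(i.+1 <= j < n.+1) (-1) ^+ (i + j) *: S j i.
(* In the first sum, [j = i] and [j = i.+1] give [F i - F i.+1], and [Tgt] turns larger [j] into
   [- B i]. In the second, [Tlt] turns [j <= i] into [- A i.+1]. *)
transitivity (\sum_(0 <= i < n.+1) (A i + (F i - F i.+1) - B i)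
  + \sum_(0 <= i < n) (B i - A i.+1)).
  congr (_ + _); apply: eq_big_nat => i lei.
    rewrite (@big_cat_nat _ _ _ i) //=; [|lia..].
    rewrite (@big_ltn _ _ _ i); last lia.
    rewrite (@big_ltn _ _ _ i.+1); last lia.
    rewrite !(Tid i) //; [|lia..].
    rewrite addnn -signr_odd odd_double scale1r addnS addnn.
    rewrite exprS -[_ ^+ _.*2]signr_odd odd_double mulr1 scaleN1r -!addrA.
    congr (_ + (_ + (_ + _))).
    rewrite big_add1 /= -sumrN; apply: eq_big_nat => j lej.
    by rewrite Tgt; [rewrite addnS exprS mulN1r scaleNr | lia].
  rewrite (@big_cat_nat _ _ _ i.+1) //=; last lia.
  rewrite addrC; congr (_ + _).
  rewrite /A -sumrN; apply: eq_big_nat => j lej.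
  by rewrite Tlt; [rewrite addSn exprS mulN1r scaleNr opprK | lia].
have telF : \sum_(0 <= i < n.+1) (F i - F i.+1) = F 0 - F n.+1.
  rewrite -opprB -telescope_sumr // -sumrN.
  by apply: eq_bigr => i _; rewrite opprB.
rewrite !sumrB big_split /= telF.
(* The ranges can be matched because [A 0] and [B n] are empty sums. *)
have -> : \sum_(0 <= i < n.+1) A i = \sum_(0 <= i < n) A i.+1.
  by rewrite big_nat_recl // /A [X in X + _]big_geq // add0r.
have -> : \sum_(0 <= i < n.+1) B i = \sum_(0 <= i < n) B i.
  by rewrite big_nat_recr //= /B [X in _ + X]big_geq // addr0.
by rewrite addrA subrK addrAC subrr add0r.
Qed.

(** * The prism operator as a chain homotopy *)

Section Homotopy.
Variables (R : pzRingType) (G G' : quiver) (p q : quiver_map G G').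
Hypothesis epq : mapV p =1 mapV q.

Definition prism_chain (n : nat) (f : quiver_map (simplex n) G) : chain R G' n.+1 :=
  \sum_(i < n.+1) (-1) ^+ i *: free_gen R (prism epq i f).

Definition homotopy (n : nat) : {linear chain R G n -> chain R G' n.+1} :=
  free_ext (@prism_chain n).

Lemma homotopy_gen (n : nat) (f : quiver_map (simplex n) G) :
  homotopy n (free_gen R f) =
  \sum_(0 <= i < n.+1) (-1) ^+ i *: free_gen R (prism epq i f).
Proof. by rewrite [LHS]free_ext_gen big_mkord. Qed.

Lemma diff_gen_nat (H : quiver) (n : nat) (f : quiver_map (simplex n.+1) H) :
  diff R H n.+1 (free_gen R f) =
  \sum_(0 <= j < n.+2) (-1) ^+ j *: free_gen R (qcomp f (face (inord j))).
Proof.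
by rewrite diff_gen big_mkord; apply: eq_bigr => j _; rewrite inord_val.
Qed.

Lemma diff_homotopy_gen (n : nat) (f : quiver_map (simplex n) G) :
  diff R G' n.+1 (homotopy n (free_gen R f)) =
  \sum_(0 <= i < n.+1) \sum_(0 <= j < n.+2)
    (-1) ^+ (i + j) *: free_gen R (qcomp (prism epq i f) (face (inord j))).
Proof.
rewrite homotopy_gen linear_sum; apply: eq_bigr => i _.
rewrite linearZZ diff_gen_nat scaler_sumr; apply: eq_bigr => j _.
by rewrite scalerA exprD.
Qed.

(** Degree zero is separate: [diff] stays in degree [0.-1 = 0] there, so applying [homotopy] after
    it would land in degree 1. *)
Lemma homotopy0 (x : chain R G 0) :
  diff R G' 1 (homotopy 0 x) = chain_map R q 0 x - chain_map R p 0 x.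
Proof.
pose l : {linear _ -> _} := diff R G' 1 \o homotopy 0.
pose r : {linear _ -> _} := chain_map R q 0 \- chain_map R p 0.
apply: (@free_linear_eq _ _ _ l r) => f.
rewrite -[l _]/(diff R G' 1 (homotopy 0 _)) diff_homotopy_gen.
rewrite -[r _]/(chain_map R q 0 _ - chain_map R p 0 _) !chain_map_gen.
rewrite -(mix0 epq) -(mix_max epq) -[LHS]addr0.
(* The second sum is empty for [n = 0], so [S] gets the default value 0. *)
rewrite -(@prism_sum _ _ 0 (fun j i => free_gen R (qcomp (prism epq i f) (face (inord j))))
   (fun _ _ => 0) (fun j => free_gen R (mix epq j f))); [|lia| |lia].
  by rewrite [X in _ = _ + X]big_geq.
move=> i j lei ij; rewrite prism_face_id //; rewrite ?inordK //; lia.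
Qed.

Lemma homotopyS (n : nat) (x : chain R G n.+1) :
  diff R G' n.+2 (homotopy n.+1 x) + homotopy n (diff R G n.+1 x) =
  chain_map R q n.+1 x - chain_map R p n.+1 x.
Proof.
pose l : {linear _ -> _} :=
  (diff R G' n.+2 \o homotopy n.+1) \+ (homotopy n \o diff R G n.+1).
pose r : {linear _ -> _} := chain_map R q n.+1 \- chain_map R p n.+1.
apply: (@free_linear_eq _ _ _ l r) => f.
rewrite -[l _]/(diff R G' n.+2 (homotopy n.+1 _) + homotopy n (diff R G n.+1 _)).
rewrite -[r _]/(chain_map R q n.+1 _ - chain_map R p n.+1 _) !chain_map_gen.
rewrite diff_homotopy_gen -(mix0 epq) -(mix_max epq).
rewrite -(@prism_sum _ _ n.+1
   (fun j i => free_gen R (qcomp (prism epq i f) (face (inord j))))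
   (fun j i => free_gen R (prism epq i (qcomp f (face (inord j)))))
   (fun j => free_gen R (mix epq j f))).
(* The homotopy of a boundary has its outer sum over faces, [prism_sum] over prisms. *)
- congr (_ + _); rewrite exchange_big /= diff_gen_nat linear_sum.
  apply: eq_bigr => j _; rewrite linearZZ homotopy_gen scaler_sumr.
  by apply: eq_bigr => i _; rewrite scalerA -exprD addnC.
- move=> i j ji; congr free_gen; apply: prism_face_lt; rewrite !inordK //; lia.
- by move=> i j lei ij; rewrite prism_face_id //; rewrite ?inordK //; lia.
- move=> i j ij; congr free_gen; apply: prism_face_gt; rewrite !inordK //; lia.
Qed.

Lemma homotopic_on_cycles (n : nat) (x : chain R G n) :
  diff R G n x = 0 ->
  exists y, diff R G' n.+1 y = chain_map R q n x - chain_map R p n x.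
Proof.
case: n x => [|n] x dx; first by exists (homotopy 0 x); apply: homotopy0.
by exists (homotopy n.+1 x); rewrite -homotopyS dx linear0 addr0.
Qed.

Lemma simp_homology_map_homotopic (n : nat) :
  simp_homology_map (R := R) q n =1 simp_homology_map p n.
Proof.
move=> x; rewrite -[x]reprK.
rewrite ![simp_homology_map _ _ _](homology_mapE (chain_map_diff _ (n := n.+1))).
apply/pi_quot_eq/asboolP.
have [y dy] := homotopic_on_cycles (eqP (cycleP (repr x))).
by exists y; rewrite dy raddfB.
Qed.

End Homotopy.

(** * Functoriality of homology *)

Lemma chain_map_comp (R : pzRingType) (G G' G'' : quiver)
    (g : quiver_map G' G'') (f : quiver_map G G') (n : nat) (x : chain R G n) :
  chain_map R g n (chain_map R f n x) = chain_map R (qcomp g f) n x.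
Proof.
pose l : {linear _ -> _} := chain_map R g n \o chain_map R f n.
apply: (@free_linear_eq _ _ _ l (chain_map R (qcomp g f) n)) => h.
by rewrite -[l _]/(chain_map R g n (chain_map R f n _)) !chain_map_gen qcompA.
Qed.

Lemma chain_map_id (R : pzRingType) (G : quiver) (n : nat) (x : chain R G n) :
  chain_map R (qid G) n x = x.
Proof.
pose r : {linear chain R G n -> chain R G n} := idfun.
apply: (@free_linear_eq _ _ _ (chain_map R (qid G) n) r) => h.
by rewrite chain_map_gen qcomp_idl.
Qed.

Lemma simp_homology_map_comp (R : pzRingType) (G G' G'' : quiver)
    (g : quiver_map G' G'') (f : quiver_map G G') (n : nat)
    (x : simp_homology R G n) :
  simp_homology_map g n (simp_homology_map f n x) =
  simp_homology_map (qcomp g f) n x.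
Proof.
have hmE := homology_mapE (chain_map_diff _ (n := n.+1)).
rewrite -[x]reprK [simp_homology_map f _ _]hmE.
rewrite [LHS]hmE [RHS]hmE.
by congr (homology_class _ _); apply: val_inj; apply: chain_map_comp.
Qed.

Lemma simp_homology_map_id (R : pzRingType) (G : quiver) (n : nat)
    (x : simp_homology R G n) :
  simp_homology_map (qid G) n x = x.
Proof.
rewrite -[x in LHS]reprK.
rewrite [LHS](homology_mapE (chain_map_diff _ (n := n.+1))) -[RHS]reprK.
by congr (homology_class _ _); apply: val_inj; apply: chain_map_id.
Qed.

Theorem corollary5p2 (R : comPzRingType) :
  exists Phi : forall (G : quiver) (n : nat),
      {linear simp_homology R G n -> simp_homology R (reduced G) n},
    (forall (G : quiver) (n : nat), bijective (Phi G n)) /\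
    (forall (G G' : quiver) (m : quiver_map G G') (n : nat)
        (x : simp_homology R G n),
      Phi G' n (simp_homology_map m n x) =
      simp_homology_map (reduced_map m) n (Phi G n x)).
Proof.
exists (fun G n => simp_homology_map (reduced_proj G) n).
split=> [G n|G G' m n x] /=.
  exists (simp_homology_map (reduced_section G) n) => x /=.
    (* Section after projection fixes vertices but may move edges, so it is the identity only up to
       homotopy. *)
    rewrite simp_homology_map_comp -[RHS]simp_homology_map_id.
    exact: simp_homology_map_homotopic.
  (* Projection after section is the identity as a quiver map. *)
  rewrite simp_homology_map_comp -[RHS]simp_homology_map_id.
  by congr (simp_homology_map _ n x); apply: reduced_map_eqV.
(* The naturality square already commutes for quiver maps: both composites end in a reduced digraph
   and agree on vertices. *)
rewrite !simp_homology_map_comp.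
by congr (simp_homology_map _ n x); apply: reduced_map_eqV.
Qed.
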